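(* $\langle\forall^\to\exists\forall\rangle\not\le_{\sf m}\langle\forall\exists\forall\rangle$.
   Context: Quantifiers range over $\omega$. Instances are (tuples of) total computable functions, i.e. computable elements of $\omega^\omega$; spaces such as $\omega\times\omega^\omega$, $(\omega^\omega)^\omega$ are identified with $\omega^\omega$ by computable pairing. $0^\infty$ is the constantly zero sequence. $\langle\forall^\to\exists\forall\rangle$ is the formula, for instances $(p,x)=(p_n,x^n_m)_{n,m\in\omega}$ with $p_n,x^n_m\in\omega^\omega$: $\forall n\,(p_n=0^\infty\to\exists m.\ x^n_m=0^\infty)$. It is a complete formula for the class of $\forall^\to\exists\forall$-formulas, i.e. formulas $\forall a[\forall b\,\gamma(a,b,x)\to\exists c\,\forall d\,\theta(a,c,d,x)]$ with $\gamma,\theta$ bounded. A witness for $\langle\forall^\to\exists\forall\rangle(p,x)$ is a partial function $f:\omega\rightharpoonup\omega$ (presented by an element of $\omega^\omega$ enumerating its graph) such that for every $n$ with $p_n=0^\infty$, $f(n)$ is defined and $x^n_{f(n)}=0^\infty$. $\langle\forall\exists\forall\rangle$ is the formula, for instances $y=(y_n(m))_{n,m\in\omega}$ with $y_n(m)\in\omega^\omega$: $\forall n\,\exists m.\ y_n(m)=0^\infty$. A witness for $\langle\forall\exists\forall\rangle(y)$ is a function $f\in\omega^\omega$ with $y_n(f(n))=0^\infty$ for all $n$. (In both cases computably recoverable parts of witnesses are omitted.) $\varphi\le_{\sf m}\psi$ if there are computable functions $\eta,r_-,r_+$ (type-two computable functionals, possibly partial but defined wherever required) such that for every instance $x$ of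 $\varphi$: $\varphi(x)$ is true iff $\psi(\eta(x))$ is true; if $\alpha$ is a witness for $\varphi(x)$ then $r_-(\alpha,x)$ is a witness for $\psi(\eta(x))$; if $\alpha$ is a witness for $\psi(\eta(x))$ then $r_+(\alpha,x)$ is a witness for $\varphi(x)$ (witnesses $\alpha$ are not required to be computable). *)

(* Defs.v *)
From Stdlib Require Import Arith Cantor.

Set Implicit Arguments.

Notation baire := (nat -> nat).

Notation "⟨ a , b ⟩" := (Cantor.to_nat (a, b)) (at level 0, format "⟨ a ,  b ⟩").

(* Kleene's mu-recursive functionals, with tuples of numbers coded by Cantor
   pairing, so that every program has one numerical input, and with the type-one
   argument accessed as an oracle. *)
Inductive code : Type :=
| Zero
| Succ
| Fst
| Snd
| Oracle
| Pair (f g : code)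
| Comp (f g : code)
| Prec (f g : code)
| Mu (f : code).

Fixpoint prec_graph (F G : nat -> nat -> Prop) (a k r : nat) : Prop :=
  match k with
  | 0 => F a r
  | S k' => exists i, prec_graph F G a k' i /\ G ⟨a, ⟨k', i⟩⟩ r
  end.

(* [eval o c n r]: the program [c] with oracle [o] halts on input [n] with
   output [r]. *)
Fixpoint eval (o : baire) (c : code) (n r : nat) : Prop :=
  match c with
  | Zero => r = 0
  | Succ => r = S n
  | Fst => r = fst (Cantor.of_nat n)
  | Snd => r = snd (Cantor.of_nat n)
  | Oracle => r = o n
  | Pair f g => exists a b, eval o f n a /\ eval o g n b /\ r = ⟨a, b⟩
  | Comp f g => exists m, eval o g n m /\ eval o f m r
  | Prec f g =>
      prec_graph (eval o f) (eval o g)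
        (fst (Cantor.of_nat n)) (snd (Cantor.of_nat n)) r
  | Mu f =>
      eval o f ⟨n, r⟩ 0 /\
      forall j, j < r -> exists i, eval o f ⟨n, j⟩ (S i)
  end.

(* A code [c] names a partial computable functional on Baire space;
   [computes c p q] says that it is defined at [p] with value [q]. *)
Definition computes (c : code) (p q : baire) : Prop :=
  forall n, eval p c n (q n).

Definition computable (x : baire) : Prop :=
  exists c, computes c (fun _ => 0) x.

Definition join (p q : baire) : baire :=
  fun n => if Nat.even n then p (Nat.div2 n) else q (Nat.div2 n).

Definition left_part (z : baire) : baire := fun k => z (2 * k).

Definition right_part (z : baire) : baire := fun k => z (2 * k + 1).

Definition component (z : baire) (n : nat) : baire := fun k => z ⟨n, k⟩.

Definition is_zero (p : baire) : Prop := forall k, p k = 0.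

(* Truth of the formula at an instance, and the witnesses for an instance
   ([witness x w]: [w] is a witness for the formula at [x]). Instances are the
   computable elements of Baire space; see [m_reducible]. Witnesses need not be
   computable. *)
Record formula : Type := Formula {
  holds : baire -> Prop;
  witness : baire -> baire -> Prop
}.

Definition m_reducible (phi psi : formula) : Prop :=
  exists eta r_minus r_plus : code,
  forall x, computable x ->
  exists y, computes eta x y /\
    (holds phi x <-> holds psi y) /\
    (forall a, witness phi x a ->
      exists b, computes r_minus (join a x) b /\ witness psi y b) /\
    (forall b, witness psi y b ->
      exists a, computes r_plus (join b x) a /\ witness phi x a).

(* An instance [z] of the first formula is the pair (p, x) with
   p_n = [premise z n] and x^n_m = [conclusion z n m]. *)
Definition premise (z : baire) (n : nat) : baire :=
  component (left_part z) n.

Definition conclusion (z : baire) (n m : nat) : baire :=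
  component (component (right_part z) n) m.

(* [a] enumerates the graph of the partial function [f]. The value 0 means "no
   information at this stage", so that finite graphs, including the empty one,
   have enumerations; [S ⟨n, m⟩] puts (n, m) into the graph. *)
Definition enumerates (a : baire) (f : nat -> option nat) : Prop :=
  forall n m, f n = Some m <-> exists k, a k = S ⟨n, m⟩.

Definition forall_imp_exists_forall : formula := {|
  holds z :=
    forall n, is_zero (premise z n) -> exists m, is_zero (conclusion z n m);
  witness z a :=
    exists f : nat -> option nat, enumerates a f /\
    forall n, is_zero (premise z n) ->
      exists m, f n = Some m /\ is_zero (conclusion z n m)
|}.

Definition forall_exists_forall : formula := {|
  holds y := forall n, exists m, is_zero (component (component y n) m);
  witness y f := forall n, is_zero (component (component y n) (f n))
|}.

(* Main.v *)
Require Import Defs.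
From Stdlib Require Import Arith Cantor Lia.

(** The zero instance has the witness n |-> 0. Pushed through the reduction and
    back, it is answered by a number [m] for the index 0, and this answer depends
    only on a finite part of the instance and a finite part [g] of the witness on
    the right-hand side. Beyond that part, refute x^0_m. The formula stays true,
    so the right-hand side has a witness; moreover [g] stays correct: an error
    in [g] would be visible after finitely many steps, and beyond these p_0 could
    be made nonzero, whereupon n |-> 0 would again be a witness, the value at 0
    being irrelevant, and would be mapped to an extension of the erroneous [g].
    So [g] extends to a witness, and the refuted answer [m] is given again. *)

Definition agree (N : nat) (p q : baire) : Prop := forall i, i < N -> p i = q i.

Lemma agree_le N N' p q : N <= N' -> agree N' p q -> agree N p q.
Proof. intros H A i Hi; apply A; lia. Qed.

Lemma agree_join N p p' q q' :
  agree N p p' -> agree N q q' -> agree N (join p q) (join p' q').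
Proof.
  intros A B i Hi; unfold join.
  assert (Nat.div2 i <= i) by (apply Nat.div2_decr; lia).
  destruct (Nat.even i); [apply A | apply B]; lia.
Qed.

(** Finitely many bounds add up to a common one, by monotonicity. *)
Lemma bounded_collection (P : nat -> nat -> Prop) :
  (forall i N N', N <= N' -> P i N -> P i N') ->
  forall K, (forall i, i < K -> exists N, P i N) ->
  exists N, forall i, i < K -> P i N.
Proof.
  intros mono; induction K as [|K IH]; intros H.
  - exists 0; lia.
  - destruct IH as [N HN]; [intros i Hi; apply H; lia|].
    destruct (H K) as [N' HN']; [lia|].
    exists (N + N'); intros i Hi.
    destruct (Nat.eq_dec i K) as [->|ne].
    + apply (mono _ N'); [lia|exact HN'].
    + apply (mono _ N); [lia|apply HN; lia].
Qed.

Lemma eval_functional o c n r r' : eval o c n r -> eval o c n r' -> r = r'.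
Proof.
  revert n r r'; induction c as [| | | | |f IHf g IHg|f IHf g IHg|f IHf g IHg|f IHf];
    simpl; intros n r r' H H'; try congruence.
  - destruct H as (a & b & Ha & Hb & ->), H' as (a' & b' & Ha' & Hb' & ->).
    rewrite (IHf _ _ _ Ha Ha'), (IHg _ _ _ Hb Hb'); reflexivity.
  - destruct H as (m & Hm & H), H' as (m' & Hm' & H').
    rewrite (IHg _ _ _ Hm Hm') in H; exact (IHf _ _ _ H H').
  - revert r r' H H'.
    induction (snd (of_nat n)) as [|k IHk]; simpl; intros r r' H H'.
    + exact (IHf _ _ _ H H').
    + destruct H as (i & Hi & H), H' as (i' & Hi' & H').
      rewrite (IHk _ _ Hi Hi') in H; exact (IHg _ _ _ H H').
  - destruct H as [H L], H' as [H' L'].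
    destruct (Nat.lt_trichotomy r r') as [lt|[e|lt]]; [|exact e|].
    + destruct (L' _ lt) as [i Hi]; discriminate (IHf _ _ _ H Hi).
    + destruct (L _ lt) as [i Hi]; discriminate (IHf _ _ _ H' Hi).
Qed.

Lemma eval_continuous o c n r :
  eval o c n r -> exists N, forall o', agree N o o' -> eval o' c n r.
Proof.
  revert n r; induction c as [| | | | |f IHf g IHg|f IHf g IHg|f IHf g IHg|f IHf];
    simpl; intros n r H; try (exists 0; intros; assumption).
  - exists (S n); intros o' A; rewrite <- A; [exact H|lia].
  - destruct H as (a & b & Ha & Hb & ->).
    destruct (IHf _ _ Ha) as [N HN], (IHg _ _ Hb) as [N' HN'].
    exists (N + N'); intros o' A; exists a, b; repeat split.
    + apply HN, (agree_le _ (N + N')); [lia|exact A].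
    + apply HN', (agree_le _ (N + N')); [lia|exact A].
  - destruct H as (m & Hm & H).
    destruct (IHg _ _ Hm) as [N HN], (IHf _ _ H) as [N' HN'].
    exists (N + N'); intros o' A; exists m; split.
    + apply HN, (agree_le _ (N + N')); [lia|exact A].
    + apply HN', (agree_le _ (N + N')); [lia|exact A].
  - revert r H; induction (snd (of_nat n)) as [|k IHk]; simpl; intros r H.
    + exact (IHf _ _ H).
    + destruct H as (m & Hm & H).
      destruct (IHk _ Hm) as [N HN], (IHg _ _ H) as [N' HN'].
      exists (N + N'); intros o' A; exists m; split.
      * apply HN, (agree_le _ (N + N')); [lia|exact A].
      * apply HN', (agree_le _ (N + N')); [lia|exact A].
  - destruct H as [H L].
    destruct (IHf _ _ H) as [N HN].
    (* The search made finitely many failed tests before [r]; their uses need a common bound. *)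
    destruct (bounded_collection
      (fun j N => forall o', agree N o o' -> exists i, eval o' f ⟨n, j⟩ (S i)))
      with (K := r) as [N' HN'].
    + intros j M M' le HM o' A; apply HM, (agree_le _ M'); assumption.
    + intros j lt; destruct (L j lt) as [i Hi], (IHf _ _ Hi) as [M HM].
      exists M; intros o' A; exists i; auto.
    + exists (N + N'); intros o' A; split.
      * apply HN, (agree_le _ (N + N')); [lia|exact A].
      * intros j lt; apply HN'; [exact lt|].
        apply (agree_le _ (N + N')); [lia|exact A].
Qed.

(** The computations of the first [N] values survive on nearby oracles, and single-valuedness of
    [eval] identifies their results with those of [q']. *)
Lemma computes_continuous c p q N :
  computes c p q ->
  exists M, forall p' q', agree M p p' -> computes c p' q' -> agree N q q'.
Proof.
  intros H.
  destruct (bounded_collection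
    (fun i M => forall p', agree M p p' -> eval p' c i (q i))) with (K := N)
    as [M HM].
  - intros i M M' le HM p' A; apply HM, (agree_le _ M'); assumption.
  - intros i _; apply eval_continuous, H.
  - exists M; intros p' q' A H' i Hi.
    exact (eval_functional _ _ _ _ _ (HM i Hi p' A) (H' i)).
Qed.

Fixpoint const_code (v : nat) : code :=
  match v with
  | 0 => Zero
  | S v => Comp Succ (const_code v)
  end.

Lemma eval_const_code o v n : eval o (const_code v) n v.
Proof.
  induction v as [|v IH]; simpl; [reflexivity|exists v; auto].
Qed.

Lemma computable_cons z : computable (fun k => z (S k)) -> computable z.
Proof.
  intros [c H].
  (* Recursion serves as case distinction: the step discards the previous value and runs [c] at the
     predecessor. [Pair Fst Snd] acts as the identity. *)
  exists (Comp (Prec (const_code (z 0)) (Comp c (Comp Fst Snd)))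
               (Pair Zero (Pair Fst Snd))).
  intros n; cbn [eval].
  exists ⟨0, n⟩; split.
  - exists 0, n; repeat split.
    exists (fst (of_nat n)), (snd (of_nat n)); repeat split.
    rewrite <- surjective_pairing, cancel_to_of; reflexivity.
  - rewrite cancel_of_to; simpl fst; simpl snd.
    induction n as [|n IH]; cbn [prec_graph].
    + apply eval_const_code.
    + exists (z n); split; [exact IH|].
      exists n; split; [|apply H].
      exists ⟨n, z n⟩; rewrite !cancel_of_to; split; reflexivity.
Qed.

(** Every instance given to the reduction below has finite support. *)
Lemma computable_eventually_zero s z : (forall i, s <= i -> z i = 0) -> computable z.
Proof.
  revert z; induction s as [|s IH]; intros z H.
  - exists Zero; intros n; apply H; lia.
  - apply computable_cons, IH; intros i Hi; apply H; lia.
Qed.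

Definition delta (c : nat) : baire := fun i => if i =? c then 1 else 0.

Lemma delta_eq c : delta c c = 1.
Proof. unfold delta; now rewrite Nat.eqb_refl. Qed.

Lemma delta_neq c i : i <> c -> delta c i = 0.
Proof. intros H; unfold delta; now rewrite (proj2 (Nat.eqb_neq i c) H). Qed.

Lemma to_nat_ge a b : a <= ⟨a, b⟩ /\ b <= ⟨a, b⟩.
Proof. pose proof (to_nat_non_decreasing a b); lia. Qed.

Lemma to_nat_inj_pair a b c d : ⟨a, b⟩ = ⟨c, d⟩ -> a = c /\ b = d.
Proof. intros H; apply to_nat_inj in H; now injection H. Qed.

(** Positions in an instance: [premise z n k] is [z (premise_index n k)] by conversion, and
    similarly for conclusions. Parity separates the two kinds. *)
Definition premise_index (n k : nat) : nat := 2 * ⟨n, k⟩.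
Definition conclusion_index (n m k : nat) : nat := 2 * ⟨n, ⟨m, k⟩⟩ + 1.

Definition constant_graph (m : nat) : baire := fun k => S ⟨k, m⟩.

Lemma enumerates_constant m : enumerates (constant_graph m) (fun _ => Some m).
Proof.
  intros n m'; split.
  - intros [= <-]; exists n; reflexivity.
  - intros [k [= H]]; apply to_nat_inj_pair in H; destruct H as [_ ->]; reflexivity.
Qed.

Lemma constant_witness z m :
  (forall n, is_zero (premise z n) -> is_zero (conclusion z n m)) ->
  witness forall_imp_exists_forall z (constant_graph m).
Proof.
  intros H; exists (fun _ => Some m); split; [apply enumerates_constant|].
  intros n Hn; exists m; auto.
Qed.

Theorem theorem4p17 : ~ m_reducible forall_imp_exists_forall forall_exists_forall.
Proof.
  intros (eta & rm & rp & red).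
  destruct (red (fun _ => 0)) as (y0 & _ & _ & back0 & forth0).
  { apply (computable_eventually_zero 0); reflexivity. }
  destruct (back0 (constant_graph 0)) as (g & Hg & Wg).
  { apply constant_witness; intros n _ k; reflexivity. }
  destruct (forth0 g Wg) as (a & Ha & f & Hf & Wa).
  destruct (Wa 0) as (m & fm & _); [intros k; reflexivity|].
  destruct (proj1 (Hf 0 m) fm) as [k Hk].
  (* Stage [k] of [a], which announces [m], uses [g] and the instance only below [N]; in turn [g]
     below [N] uses its input only below [M]. *)
  destruct (computes_continuous _ _ _ (S k) Ha) as [N HN].
  destruct (computes_continuous _ _ _ N Hg) as [M HM].
  set (c1 := conclusion_index 0 m (N + M)).
  assert (c1_ge : N + M <= c1).
  { unfold c1, conclusion_index.
    pose proof (to_nat_ge m (N + M)); pose proof (to_nat_ge 0 ⟨m, N + M⟩); lia. }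
  set (z1 := delta c1).
  assert (concl1 : forall n m', m' <> m -> is_zero (conclusion z1 n m')).
  { intros n m' ne k'; apply delta_neq; intros e.
    unfold c1, conclusion_index in e.
    assert (e' : ⟨n, ⟨m', k'⟩⟩ = ⟨0, ⟨m, N + M⟩⟩) by lia.
    apply to_nat_inj_pair in e'; destruct e' as [_ e'].
    apply to_nat_inj_pair in e'; tauto. }
  destruct (red z1) as (y1 & Hy1 & _ & back1 & forth1).
  { apply (computable_eventually_zero (S c1)).
    intros i Hi; apply delta_neq; lia. }
  (* Only [m] has been spoiled as an answer, so any other constant would do. *)
  destruct (back1 (constant_graph (S m))) as (b1 & _ & Wb1).
  { apply constant_witness; intros n _; apply concl1; lia. }
  set (h := fun i => if i <? N then g i else b1 i).
  assert (Wh : witness forall_exists_forall y1 h).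
  { intros i; unfold h; destruct (Nat.ltb_spec i N) as [lt|_]; [|apply Wb1].
    intros j; unfold component.
    set (q := ⟨i, ⟨g i, j⟩⟩).
    destruct (computes_continuous _ _ _ (S q) Hy1) as [U HU].
    (* Past [U], the change leaves entry [q] of the image intact; past [M], it leaves [g] below [N]
       intact. *)
    set (c2 := premise_index 0 (M + U)).
    assert (c2_ge : M + U <= c2).
    { unfold c2, premise_index; pose proof (to_nat_ge 0 (M + U)); lia. }
    set (z2 := fun i => z1 i + delta c2 i).
    destruct (red z2) as (y2 & Hy2 & _ & back2 & _).
    { apply (computable_eventually_zero (S (c1 + c2))).
      intros l Hl; unfold z2, z1; rewrite !delta_neq by lia; reflexivity. }
    destruct (back2 (constant_graph 0)) as (b2 & Hb2 & Wb2).
    (* Index 0 is exempt, its premise being nonzero at [c2]; for other [n], [c1] does not touch the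
       conclusions. *)
    { apply constant_witness; intros n Hn k'.
      assert (n <> 0).
      { intros ->; specialize (Hn (M + U)).
        change (z1 c2 + delta c2 c2 = 0) in Hn.
        rewrite delta_eq in Hn; lia. }
      change (z1 (conclusion_index n 0 k') + delta c2 (conclusion_index n 0 k') = 0).
      unfold z1; rewrite !delta_neq; [reflexivity| |].
      - unfold c2, premise_index, conclusion_index; lia.
      - unfold c1, conclusion_index; intros e.
        assert (e' : ⟨n, ⟨0, k'⟩⟩ = ⟨0, ⟨m, N + M⟩⟩) by lia.
        apply to_nat_inj_pair in e'; tauto. }
    assert (eg : g i = b2 i).
    { refine (HM _ _ _ Hb2 i lt); apply agree_join; intros l Hl; [reflexivity|].
      unfold z2, z1; rewrite !delta_neq by lia; reflexivity. }
    assert (ey : y1 q = y2 q).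
    { refine (HU _ _ _ Hy2 q _); [|lia].
      intros l Hl; unfold z2; rewrite (delta_neq c2) by lia; lia. }
    rewrite ey; unfold q; rewrite eg; apply Wb2. }
  destruct (forth1 h Wh) as (a' & Ha' & f' & Hf' & Wa').
  destruct (Wa' 0) as (m' & fm' & Zm').
  { intros k'; apply delta_neq; unfold c1, conclusion_index; lia. }
  (* Below [N], [h] looks like [g] and [z1] like zero. *)
  assert (ea : a k = a' k).
  { refine (HN _ _ _ Ha' k _); [|lia].
    apply agree_join; intros l Hl.
    - unfold h; destruct (Nat.ltb_spec l N); [reflexivity|lia].
    - unfold z1; rewrite delta_neq by lia; reflexivity. }
  assert (fm1 : f' 0 = Some m) by (apply Hf'; exists k; congruence).
  rewrite fm1 in fm'; injection fm' as <-.
  specialize (Zm' (N + M)); change (delta c1 c1 = 0) in Zm'.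
  rewrite delta_eq in Zm'; discriminate.
Qed.
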